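(* The following hold. (1) If $\mathbf{V}$ is a pseudovariety, then $\mathrm{PL}_{\mathbf{V}}$ is maximal amongst complex functors fixing $\mathbf{V}$; that is, $$\mathrm{PL}_{\mathbf{V}} = \bigvee \{\, \mathcal{C} \in \mathbf{CF} : \mathbf{V} \subseteq \mathrm{Fix}(\mathcal{C}) \,\}.$$ Consequently, the map $\mathrm{PL}_{(-)} : \mathbf{PV}^{\mathrm{op}} \to \mathbf{CF}$, $\mathbf{V} \mapsto \mathrm{PL}_{\mathbf{V}}$, is upper adjoint to $\mathrm{Fix} : \mathbf{CF} \to \mathbf{PV}^{\mathrm{op}}$. Additionally, $\mathrm{PL}_{\mathbf{V}}$ is a complex monad. (2) Altogether, there is a commuting triangle of Galois connections between the complete lattices $\mathbf{CF}$, $\mathbf{CM}$ and $\mathbf{PV}^{\mathrm{op}}$: the surjective monad completion map $(-)^{\infty} : \mathbf{CF} \to \mathbf{CM}$ is lower adjoint to the inclusion $\mathbf{CM} \hookrightarrow \mathbf{CF}$; the surjective map $\mathrm{Fix} : \mathbf{CF} \to \mathbf{PV}^{\mathrm{op}}$ is lower adjoint to the injective map $\mathrm{PL}_{(-)} : \mathbf{PV}^{\mathrm{op}} \to \mathbf{CF}$; the surjective restriction $\mathrm{Fix} : \mathbf{CM} \to \mathbf{PV}^{\mathrm{op}}$ is lower adjoint to the injective map $\mathrm{PL}_{(-)} : \mathbf{PV}^{\mathrm{op}} \to \mathbf{CM}$; and the triangle of lower adjoints and the triangle of upper adjoints both commute.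
   Context: $\mathsf{FSgp}$ is the category of finite semigroups (the empty semigroup is allowed) and homomorphisms; its regular epimorphisms are the surjective homomorphisms. For a finite semigroup $S$, $\mathcal{P}(S)$ is the semigroup of non-empty subsets of $S$ under $XY = \{xy : x\in X, y\in Y\}$, and $\mathrm{sing}(S) \subseteq \mathcal{P}(S)$ is the subsemigroup of singletons. A homomorphism $\varphi : S \to T$ extends to $\dot\varphi : \mathcal{P}(S) \to \mathcal{P}(T)$, $X \mapsto \{\varphi(x) : x \in X\}$. For $\mathcal{X}\subseteq\mathcal{P}(S)$, $\downarrow\!\mathcal{X}$ is the set of $Y \in \mathcal{P}(S)$ with $Y \subseteq X$ for some $X \in \mathcal{X}$. An $S$-complex is a subsemigroup of $\mathcal{P}(S)$ which contains $\mathrm{sing}(S)$ and is closed under taking non-empty subsets of its members. A complex functor is a functor $\mathcal{C} : \mathsf{FSgp} \to \mathsf{FSgp}$ such that $\mathcal{C}(S)$ is an $S$-complex for every $S$, $\mathcal{C}(\varphi)$ is the restriction $\dot\varphi : \mathcal{C}(S) \to \mathcal{C}(T)$ for each $\varphi : S\to T$, and $\mathcal{C}$ preserves regular epimorphisms. $\mathbf{CF}$ is the collection of complex functors, ordered by $\mathcal{C}_1 \le \mathcal{C}_2$ iff $\mathcal{C}_1(S) \subseteq \mathcal{C}_2(S)$ for all $S$; it is a complete lattice whose joins are computed pointwise (in the complete lattice of $S$-complexes under inclusion). $\mathrm{Fix}(\mathcal{C}) = \{ S \in \mathsf{FSgp} : \mathcal{C}(S) = \mathrm{sing}(S) \}$;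 this is a pseudovariety. A complex monad is a complex functor $\mathcal{C}$ admitting a monad structure whose unit components are the singleton embeddings $S \to \mathcal{C}(S)$, $x \mapsto \{x\}$, and whose multiplication components are the union maps $\mathcal{C}(\mathcal{C}(S)) \to \mathcal{C}(S)$, $\mathcal{X} \mapsto \bigcup \mathcal{X}$. $\mathbf{CM}$ is the collection of complex monads with the order inherited from $\mathbf{CF}$; it is a complete lattice. Monad completion: for $\mathcal{C} \in \mathbf{CF}$ put $\mathcal{C}^{[0]}(S) = \mathrm{sing}(S)$, $\mathcal{C}^{[n+1]}(S) = \downarrow\!\{ \bigcup \mathcal{A} : \mathcal{A} \in \mathcal{C}(\mathcal{C}^{[n]}(S)) \}$, and $\mathcal{C}^{\infty}(S) = \bigcup_n \mathcal{C}^{[n]}(S)$ (an increasing union). A relational morphism $\rho$ from $S$ to $T$ is determined by its graph $\Gamma(S,\rho,T)$, a subsemigroup of $S \times T$ projecting onto $S$. For $t \in T$, $\rho^{-1}(t) = \{ s : (s,t) \in \Gamma(S,\rho,T)\}$. The nerve of $\rho$ is the $S$-complex $\mathrm{Nrv}(S,\rho,T) = \{ X \in \mathcal{P}(S) : X \subseteq \rho^{-1}(t) \text{ for some } t \in T \}$. A pseudovariety is a class of finite semigroups closed under subsemigroups, homomorphic images and finite products; $\mathbf{PV}$ is the complete lattice of pseudovarieties under inclusion. For a pseudovariety $\mathbf{V}$, the $\mathbf{V}$-pointlikes functor $\mathrm{PL}_{\mathbf{V}}$ is the complex functor given by $\mathrm{PL}_{\mathbf{V}}(S) = \bigcap \mathrm{Nrv}(S,\rho,V)$,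 the intersection ranging over all relational morphisms $\rho$ from $S$ to some $V\in \mathbf{V}$. A Galois connection between posets is a pair of monotone maps $\delta : P_1 \to P_2$ (lower adjoint) and $\gamma : P_2 \to P_1$ (upper adjoint) with $\delta(x_1)\le x_2 \iff x_1 \le \gamma(x_2)$. *)

(* Defs.v *)
From HB Require Import structures.
From mathcomp Require Import all_boot.
From mathcomp Require Import boolp.

Set Implicit Arguments.
Unset Strict Implicit.
Unset Printing Implicit Defensive.

Local Open Scope group_scope.

Definition surj (A B : Type) (f : A -> B) : Prop := forall y, exists x, f x = y.

(* No element is required to exist: the empty semigroup is an object. *)
#[short(type="finSemigroupType")]
HB.structure Definition FinSemigroup := {T of Finite T & Semigroup T}.

HB.instance Definition _ (S T : finSemigroupType) := Finite.on (S * T)%type.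

(* A subsemigroup may be empty. *)
Record subsgp (S : finSemigroupType) := Subsgp {
  subsgp_set :> {set S};
  subsgp_closed : mulg_closed subsgp_set
}.

Definition subsgp_type (S : finSemigroupType) (A : subsgp S) : Type :=
  {x : S | x \in subsgp_set A}.
Coercion subsgp_type : subsgp >-> Sortclass.

Section SubsgpInstances.
Variables (S : finSemigroupType) (A : subsgp S).
HB.instance Definition _ := SubFinite.on (subsgp_type A).

Definition subsgp_mul (x y : A) : A :=
  exist _ (val x * val y) (subsgp_closed (valP x) (valP y)).

Lemma subsgp_mulA : associative subsgp_mul.
Proof. by move=> x y z; apply: val_inj; rewrite /= mulgA. Qed.

HB.instance Definition _ := isSemigroup.Build (subsgp_type A) subsgp_mulA.
End SubsgpInstances.

Definition prodsgp (I : finType) (F : I -> finSemigroupType) : Type :=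
  {dffun forall i, F i}.

Section ProdsgpInstances.
Variables (I : finType) (F : I -> finSemigroupType).
HB.instance Definition _ := Finite.on (prodsgp F).

Definition prodsgp_mul (f g : prodsgp F) : prodsgp F :=
  finfun (fun i => f i * g i).

Lemma prodsgp_mulA : associative prodsgp_mul.
Proof. by move=> f g h; apply/ffunP => i; rewrite !ffunE mulgA. Qed.

HB.instance Definition _ := isSemigroup.Build (prodsgp F) prodsgp_mulA.
End ProdsgpInstances.

Definition pset (S : finSemigroupType) : Type := {X : {set S} | X != set0}.

Definition Pset (S : finSemigroupType) (X : {set S}) (X0 : X != set0) : pset S :=
  exist (fun X : {set S} => X != set0) X X0.

Section Pset.
Variable S : finSemigroupType.
HB.instance Definition _ := SubFinite.on (pset S).
Implicit Types X Y : pset S.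

Lemma psetP X : exists x, x \in val X.
Proof. by apply/set0Pn; exact: valP X. Qed.

Lemma pset_mul_neq0 X Y :
  [set x * y | x in val X, y in val Y] != set0.
Proof.
have [x xX] := psetP X; have [y yY] := psetP Y.
by apply/set0Pn; exists (x * y); apply/imset2P; exists x y.
Qed.

Definition pset_mul X Y : pset S := Pset (pset_mul_neq0 X Y).

Lemma pset_mulA : associative pset_mul.
Proof.
move=> X Y Z; apply: val_inj; apply/setP => s /=; apply/imset2P/imset2P.
  move=> [x _ xX /imset2P[y z yY zZ ->] ->].
  by exists (x * y) z; rewrite ?mulgA //; apply/imset2P; exists x y.
move=> [_ z /imset2P[x y xX yY ->] zZ ->].
by exists x (y * z); rewrite ?mulgA //; apply/imset2P; exists y z.
Qed.

HB.instance Definition _ := isSemigroup.Build (pset S) pset_mulA.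

Lemma psing_neq0 (x : S) : [set x] != set0.
Proof. by apply/set0Pn; exists x; rewrite inE. Qed.

Definition psing (x : S) : pset S := Pset (psing_neq0 x).

Definition sing : {set pset S} := [set psing x | x : S].

Definition down (XX : {set pset S}) : {set pset S} :=
  [set Y : pset S | [exists X in XX, val Y \subset val X]].

End Pset.

Section Dot.
Variables (S T : finSemigroupType) (phi : {multiplicative S -> T}).

Lemma dot_neq0 (X : pset S) : phi @: val X != set0.
Proof. by have [x xX] := psetP X; apply/set0Pn; exists (phi x); apply: imset_f. Qed.

Definition dot (X : pset S) : pset T := Pset (dot_neq0 X).

Lemma dotM : {morph dot : X Y / X * Y}.
Proof.
move=> X Y; apply: val_inj; apply/setP => t /=; apply/imsetP/imset2P.
  move=> [_ /imset2P[x y xX yY ->] ->].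
  by exists (phi x) (phi y); rewrite ?imset_f // gmulfM.
move=> [_ _ /imsetP[x xX ->] /imsetP[y yY ->] ->].
by exists (x * y); rewrite ?gmulfM //; apply/imset2P; exists x y.
Qed.

HB.instance Definition _ := isMultiplicative.Build (pset S) (pset T) dot dotM.
End Dot.

Record cplx (S : finSemigroupType) := Cplx {
  cplx_subsgp :> subsgp (pset S);
  cplx_sing : sing S \subset subsgp_set cplx_subsgp;
  cplx_down : forall X Y : pset S,
    X \in subsgp_set cplx_subsgp -> val Y \subset val X ->
    Y \in subsgp_set cplx_subsgp
}.

Definition cplx_set (S : finSemigroupType) (K : cplx S) : {set pset S} :=
  subsgp_set (cplx_subsgp K).

Section Restriction.
Variables (S T : finSemigroupType) (phi : {multiplicative S -> T}).
Variables (K : cplx S) (L : cplx T).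
Hypothesis phiKL : forall X, X \in cplx_set K -> dot phi X \in cplx_set L.

Definition dot_restr (X : K) : L := exist _ (dot phi (val X)) (phiKL (valP X)).

Lemma dot_restrM : {morph dot_restr : X Y / X * Y}.
Proof. by move=> X Y; apply: val_inj; rewrite /= dotM. Qed.

HB.instance Definition _ := isMultiplicative.Build K L dot_restr dot_restrM.
End Restriction.

(* The elements of [pset K] are non-empty sets of non-empty subsets of [S]
   belonging to the complex [K]; [punion] is their union, in [pset S]. *)
Section Union.
Variables (S : finSemigroupType) (K : cplx S).

Lemma punion_neq0 (A : pset K) : \bigcup_(X in val A) val (val X) != set0.
Proof.
have [X XA] := psetP A; have [x xX] := psetP (val X).
by apply/set0Pn; exists x; apply/bigcupP; exists X.
Qed.

Definition punion (A : pset K) : pset S := Pset (punion_neq0 A).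
End Union.

Record endofunctor := Endofunctor {
  fobj :> finSemigroupType -> finSemigroupType;
  fmap : forall S T : finSemigroupType,
    {multiplicative S -> T} -> {multiplicative fobj S -> fobj T};
  fmap_id : forall S : finSemigroupType, fmap (@idfun S) =1 idfun;
  fmap_comp : forall (S T U : finSemigroupType)
    (psi : {multiplicative T -> U}) (phi : {multiplicative S -> T}),
    fmap (psi \o phi) =1 fmap psi \o fmap phi
}.
Arguments fmap F {S T} phi : rename.

Record monad_structure (F : endofunctor) := MonadStructure {
  munit : forall S : finSemigroupType, {multiplicative S -> F S};
  mmult : forall S : finSemigroupType, {multiplicative F (F S) -> F S};
  munit_natural : forall (S T : finSemigroupType)
    (phi : {multiplicative S -> T}),
    fmap F phi \o munit S =1 munit T \o phi;
  mmult_natural : forall (S T : finSemigroupType)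
    (phi : {multiplicative S -> T}),
    fmap F phi \o mmult S =1 mmult T \o fmap F (fmap F phi);
  mmult_unitl : forall S, mmult S \o munit (F S) =1 id;
  mmult_unitr : forall S, mmult S \o fmap F (munit S) =1 id;
  mmultA : forall S, mmult S \o fmap F (mmult S) =1 mmult S \o mmult (F S)
}.

(* The action on homomorphisms carries no data, being the restriction of [dot]:
   [cf_dot] makes it well defined and [cf_functor] below is the resulting
   endofunctor. The regular epimorphisms of finite semigroups are the
   surjective homomorphisms, whence [cf_surj]. *)
Record complexFunctor := ComplexFunctor {
  cf_cplx :> forall S : finSemigroupType, cplx S;
  cf_dot : forall (S T : finSemigroupType) (phi : {multiplicative S -> T}) X,
    X \in cplx_set (cf_cplx S) -> dot phi X \in cplx_set (cf_cplx T);
  cf_surj : forall (S T : finSemigroupType) (phi : {multiplicative S -> T}),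
    surj phi -> surj (dot_restr (@cf_dot S T phi))
}.

Section CfFunctor.
Variable C : complexFunctor.

Definition cf_map (S T : finSemigroupType) (phi : {multiplicative S -> T}) :
  {multiplicative C S -> C T} := dot_restr (@cf_dot C S T phi).

Lemma cf_map_id (S : finSemigroupType) : cf_map (@idfun S) =1 idfun.
Proof.
by move=> X; apply: val_inj; apply: val_inj; rewrite /= imset_id.
Qed.

Lemma cf_map_comp (S T U : finSemigroupType)
    (psi : {multiplicative T -> U}) (phi : {multiplicative S -> T}) :
  cf_map (psi \o phi) =1 cf_map psi \o cf_map phi.
Proof.
by move=> X; apply: val_inj; apply: val_inj; rewrite /= imset_comp.
Qed.

Definition cf_functor : endofunctor := Endofunctor cf_map_id cf_map_comp.
End CfFunctor.

Definition CF_le (C D : complexFunctor) : Prop :=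
  forall S : finSemigroupType, cplx_set (C S) \subset cplx_set (D S).

(* Only the components of the unit and of the multiplication are prescribed:
   that unions of members of [C (C S)] lie in [C S] is the content. *)
Definition is_complex_monad (C : complexFunctor) : Prop :=
  exists M : monad_structure (cf_functor C),
    (forall (S : finSemigroupType) (x : S), val (munit M S x) = psing x) /\
    (forall (S : finSemigroupType) (XX : C (C S)),
       val (mmult M S XX) = punion (val XX)).

Definition complexMonad : Type := {C : complexFunctor | is_complex_monad C}.

Definition CM_incl (C : complexMonad) : complexFunctor := sval C.

Definition CM_le (C D : complexMonad) : Prop := CF_le (CM_incl C) (CM_incl D).

Section Completion.
Variables (C : complexFunctor) (S : finSemigroupType).

Lemma sing_closed : mulg_closed (sing S).
Proof.
move=> _ _ /imsetP[x _ ->] /imsetP[y _ ->]; apply/imsetP; exists (x * y) => //.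
apply: val_inj; apply/setP => z; rewrite !inE; apply/imset2P/eqP => /=.
  by move=> [? ? /set1P-> /set1P->].
by move=> ->; exists x y; rewrite ?inE.
Qed.

Lemma sing_down (X Y : pset S) :
  X \in sing S -> val Y \subset val X -> Y \in sing S.
Proof.
move=> /imsetP[x _ ->] /= Yx; have [y yY] := psetP Y.
apply/imsetP; exists x => //; apply: val_inj => /=.
apply/eqP; rewrite eqEsubset Yx sub1set.
by move/subsetP: Yx => /(_ y yY) /set1P <-.
Qed.

Definition sing_cplx : cplx S :=
  @Cplx S (Subsgp sing_closed) (subxx _) sing_down.

Definition completion_step_set (K : cplx S) : {set pset S} :=
  down [set punion A | A in cplx_set (C K)].

Lemma completion_stepP (K : cplx S) (Y : pset S) :
  reflect (exists2 A : pset K, A \in cplx_set (C K) & val Y \subset val (punion A))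
    (Y \in completion_step_set K).
Proof.
rewrite inE; apply: (iffP existsP) => [[X /andP[/imsetP[A AC ->] YA]]|[A AC YA]].
  by exists A.
by exists (punion A); rewrite YA andbT; apply/imsetP; exists A.
Qed.

Lemma completion_step_incr (K : cplx S) :
  cplx_set K \subset completion_step_set K.
Proof.
apply/subsetP => X XK; apply/completion_stepP.
pose X' : K := exist _ X XK.
exists (psing X'); first by apply: (subsetP (cplx_sing (C K))); apply: imset_f.
by apply/subsetP => x xX; apply/bigcupP; exists X' => //; rewrite inE.
Qed.

Lemma completion_step_closed (K : cplx S) : mulg_closed (completion_step_set K).
Proof.
move=> X Y /completion_stepP[A AC XA] /completion_stepP[B BC YB].
apply/completion_stepP; exists (A * B).
  exact: (@subsgp_closed _ (cplx_subsgp (C K))).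
apply/subsetP => _ /imset2P[x y xX yY ->].
have /bigcupP[X' X'A xX'] := subsetP XA _ xX.
have /bigcupP[Y' Y'B yY'] := subsetP YB _ yY.
apply/bigcupP; exists (X' * Y'); first by apply/imset2P; exists X' Y'.
by apply/imset2P; exists x y.
Qed.

Lemma completion_step_sing (K : cplx S) : sing S \subset completion_step_set K.
Proof. exact: subset_trans (cplx_sing K) (completion_step_incr K). Qed.

Lemma completion_step_down (K : cplx S) (X Y : pset S) :
  X \in completion_step_set K -> val Y \subset val X ->
  Y \in completion_step_set K.
Proof.
move=> /completion_stepP[A AC XA] YX; apply/completion_stepP; exists A => //.
exact: subset_trans XA.
Qed.

Definition completion_step (K : cplx S) : cplx S :=
  @Cplx S (Subsgp (@completion_step_closed K)) (completion_step_sing K)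
    (@completion_step_down K).

Definition completion_iter (n : nat) : cplx S := iter n completion_step sing_cplx.

Definition completion_set : {set pset S} :=
  [set X : pset S | `[< exists n, X \in cplx_set (completion_iter n) >]].

Lemma completion_iter_incr m n : m <= n ->
  cplx_set (completion_iter m) \subset cplx_set (completion_iter n).
Proof.
move=> /subnK <-; elim: (n - m) => //= k IHk.
exact: subset_trans IHk (completion_step_incr _).
Qed.

Lemma completionP (X : pset S) :
  X \in completion_set <-> exists n, X \in cplx_set (completion_iter n).
Proof. by rewrite inE; split => /asboolP. Qed.

Lemma completion_closed : mulg_closed completion_set.
Proof.
move=> X Y /completionP[m Xm] /completionP[n Yn].
apply/completionP; exists (maxn m n).
apply: (@subsgp_closed _ (cplx_subsgp (completion_iter (maxn m n)))).
  exact: subsetP (completion_iter_incr (leq_maxl m n)) _ Xm.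
exact: subsetP (completion_iter_incr (leq_maxr m n)) _ Yn.
Qed.

Lemma completion_sing : sing S \subset completion_set.
Proof. by apply/subsetP => X Xs; apply/completionP; exists 0. Qed.

Lemma completion_down (X Y : pset S) :
  X \in completion_set -> val Y \subset val X -> Y \in completion_set.
Proof.
move=> /completionP[n Xn] YX; apply/completionP; exists n.
exact: cplx_down Xn YX.
Qed.

Definition completion : cplx S :=
  @Cplx S (Subsgp completion_closed) completion_sing completion_down.
End Completion.

(* The index type of a finite product may be empty, so that every
   pseudovariety contains the one-element semigroup; closure under isomorphism
   is contained in closure under homomorphic images. *)
Record pseudovariety := Pseudovariety {
  pv_mem :> finSemigroupType -> Prop;
  pv_sub : forall (S : finSemigroupType) (A : subsgp S), pv_mem S -> pv_mem A;
  pv_img : forall (S T : finSemigroupType) (phi : {multiplicative S -> T}),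
    surj phi -> pv_mem S -> pv_mem T;
  pv_prod : forall (I : finType) (F : I -> finSemigroupType),
    (forall i, pv_mem (F i)) -> pv_mem (prodsgp F)
}.

Definition PV_le (V W : pseudovariety) : Prop :=
  forall S : finSemigroupType, V S -> W S.

Definition PVop_le (V W : pseudovariety) : Prop := PV_le W V.

Section Fix.
Variable C : complexFunctor.

Definition Fix_mem (S : finSemigroupType) : Prop := cplx_set (C S) = sing S.

Lemma Fix_memP (S : finSemigroupType) :
  Fix_mem S <-> forall X, X \in cplx_set (C S) ->
    forall x y, x \in val X -> y \in val X -> x = y.
Proof.
split => [-> X /imsetP[s _ ->] x y /set1P-> /set1P-> //|h].
apply/eqP; rewrite eqEsubset cplx_sing andbT; apply/subsetP => X XC.
have [x xX] := psetP X; apply/imsetP; exists x => //.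
apply: val_inj; apply/setP => y; rewrite inE; apply/idP/eqP => [yX|-> //].
exact: h XC _ _ yX xX.
Qed.

Lemma Fix_sub (S : finSemigroupType) (A : subsgp S) : Fix_mem S -> Fix_mem A.
Proof.
move=> /Fix_memP SC; apply/Fix_memP => X XC x y xX yX.
have iM : {morph (fun a : A => val a) : a b / a * b} by [].
pose h := isMultiplicative.Build A S _ iM.
pose i : {multiplicative A -> S} := HB.pack (fun a : A => val a) h.
by apply: val_inj; apply: (SC _ (cf_dot i XC));
   [exact: (imset_f i xX)|exact: (imset_f i yX)].
Qed.

Lemma Fix_img (S T : finSemigroupType) (phi : {multiplicative S -> T}) :
  surj phi -> Fix_mem S -> Fix_mem T.
Proof.
move=> sphi /Fix_memP SC; apply/Fix_memP => Y YC.
have [X XE] := cf_surj sphi (exist _ Y YC : C T).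
have {XE} <- : dot phi (val X) = Y by have := congr1 val XE.
move=> _ _ /imsetP[x xX ->] /imsetP[y yX ->].
by rewrite (SC _ (valP X) x y).
Qed.

Lemma Fix_prod (I : finType) (F : I -> finSemigroupType) :
  (forall i, Fix_mem (F i)) -> Fix_mem (prodsgp F).
Proof.
move=> FC; apply/Fix_memP => X XC f g fX gX; apply/ffunP => i.
have pM : {morph (fun f : prodsgp F => f i) : a b / a * b}.
  by move=> a b; rewrite /= ffunE.
pose h := isMultiplicative.Build (prodsgp F) (F i) _ pM.
pose p : {multiplicative prodsgp F -> F i} :=
  HB.pack (fun f : prodsgp F => f i) h.
have /Fix_memP FCi := FC i.
by apply: (FCi _ (cf_dot p XC));
   [exact: (imset_f p fX)|exact: (imset_f p gX)].
Qed.

Definition Fix : pseudovariety := Pseudovariety Fix_sub Fix_img Fix_prod.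
End Fix.

Record relMorph (S T : finSemigroupType) := RelMorph {
  rm_graph :> subsgp (S * T)%type;
  rm_proj : forall s : S, exists t : T, (s, t) \in subsgp_set rm_graph
}.

Section Nerve.
Variables (S T : finSemigroupType) (rho : relMorph S T).

Definition rm_preim (t : T) : {set S} := [set s | (s, t) \in subsgp_set rho].

Definition nerve_set : {set pset S} :=
  [set X : pset S | [exists t, val X \subset rm_preim t]].

Lemma nerveP (X : pset S) :
  reflect (exists t, val X \subset rm_preim t) (X \in nerve_set).
Proof. by rewrite inE; apply: existsP. Qed.

Lemma nerve_closed : mulg_closed nerve_set.
Proof.
move=> X Y /nerveP[t Xt] /nerveP[u Yu]; apply/nerveP; exists (t * u).
apply/subsetP => _ /imset2P[x y xX yY ->].
have := subsetP Xt _ xX; have := subsetP Yu _ yY.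
by rewrite !inE => yu xt; exact: (subsgp_closed xt yu).
Qed.

Lemma nerve_sing : sing S \subset nerve_set.
Proof.
apply/subsetP => _ /imsetP[s _ ->]; apply/nerveP.
by have [t st] := rm_proj rho s; exists t; rewrite sub1set inE.
Qed.

Lemma nerve_down (X Y : pset S) :
  X \in nerve_set -> val Y \subset val X -> Y \in nerve_set.
Proof.
move=> /nerveP[t Xt] YX; apply/nerveP; exists t; exact: subset_trans Xt.
Qed.

Definition nerve : cplx S :=
  @Cplx S (Subsgp nerve_closed) nerve_sing nerve_down.
End Nerve.

Section Pointlikes.
Variable V : pseudovariety.

Section Object.
Variable S : finSemigroupType.

Definition PL_set : {set pset S} :=
  [set X : pset S | `[< forall (T : finSemigroupType) (rho : relMorph S T),
                V T -> X \in cplx_set (nerve rho) >]].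

Lemma PLP (X : pset S) :
  X \in PL_set <-> forall (T : finSemigroupType) (rho : relMorph S T),
    V T -> X \in cplx_set (nerve rho).
Proof. by rewrite inE; split => /asboolP. Qed.

Lemma PL_closed : mulg_closed PL_set.
Proof.
move=> X Y /PLP hX /PLP hY; apply/PLP => T rho VT.
by apply: (@nerve_closed _ _ rho); [apply: hX|apply: hY].
Qed.

Lemma PL_sing : sing S \subset PL_set.
Proof.
apply/subsetP => X Xs; apply/PLP => T rho _.
exact: (subsetP (nerve_sing rho)).
Qed.

Lemma PL_down (X Y : pset S) :
  X \in PL_set -> val Y \subset val X -> Y \in PL_set.
Proof.
move=> /PLP hX YX; apply/PLP => T rho VT.
exact: nerve_down (hX _ rho VT) YX.
Qed.

Definition PL_cplx : cplx S := @Cplx S (Subsgp PL_closed) PL_sing PL_down.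

(* By finiteness, a single relational morphism computes the pointlikes. *)
Lemma PL_witness : exists (T : finSemigroupType) (rho : relMorph S T),
  V T /\ cplx_set (nerve rho) \subset PL_set.
Proof.
pose I : finType := {X : pset S | X \notin PL_set}.
have ex (i : I) : {T : finSemigroupType & {rho : relMorph S T |
    V T /\ val i \notin cplx_set (nerve rho)}}.
  have : exists T : finSemigroupType, exists rho : relMorph S T,
      V T /\ val i \notin cplx_set (nerve rho).
    apply: contrapT => hN; move/negP: (valP i); apply; apply/PLP => T rho VT.
    by apply/negPn/negP => Xn; apply: hN; exists T, rho.
  by move=> /cid[T /cid[rho h]]; exists T, rho.
pose F (i : I) : finSemigroupType := projT1 (ex i).
pose r (i : I) : relMorph S (F i) := sval (projT2 (ex i)).
have VF i : V (F i) by have [] := svalP (projT2 (ex i)).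
have rN (i : I) : val i \notin cplx_set (nerve (r i)).
  by have [] := svalP (projT2 (ex i)).
pose G : {set S * prodsgp F} :=
  [set p | [forall i, (p.1, (p.2 : prodsgp F) i) \in subsgp_set (r i)]].
have GP s (f : prodsgp F) :
    reflect (forall i, (s, f i) \in subsgp_set (r i)) ((s, f) \in G).
  by rewrite inE; apply: forallP.
have Gm : mulg_closed G.
  move=> [s f] [t g] /GP sf /GP tg; apply/GP => i; rewrite ffunE.
  exact: (subsgp_closed (sf i) (tg i)).
have Gp s : exists f, (s, f) \in G.
  have [f fP] := fin_all_exists (fun i => rm_proj (r i) s).
  by exists (finfun f); apply/GP => i; rewrite ffunE.
exists (prodsgp F : finSemigroupType), (@RelMorph _ _ (Subsgp Gm) Gp).
split; first exact: pv_prod.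
apply/subsetP => X /nerveP[f Xf]; apply/negPn/negP => XN.
move/negP: (rN (exist _ X XN)); apply; apply/nerveP.
exists (f (exist _ X XN)); apply/subsetP => x xX; rewrite inE.
by have := subsetP Xf x xX; rewrite inE => /GP.
Qed.

End Object.

Lemma PL_dot (S T : finSemigroupType) (phi : {multiplicative S -> T}) X :
  X \in cplx_set (PL_cplx S) -> dot phi X \in cplx_set (PL_cplx T).
Proof.
move=> /PLP hX; apply/PLP => U rho VU.
pose G : {set S * U} := [set p | (phi p.1, p.2) \in subsgp_set rho].
have Gm : mulg_closed G.
  move=> [s u] [t v]; rewrite !inE /= gmulfM => su tv.
  exact: (subsgp_closed su tv).
have Gp s : exists u, (s, u) \in G.
  by have [u su] := rm_proj rho (phi s); exists u; rewrite inE.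
have /nerveP[u Xu] := hX _ (@RelMorph _ _ (Subsgp Gm) Gp) VU.
apply/nerveP; exists u; apply/subsetP => _ /imsetP[x xX ->].
by have := subsetP Xu _ xX; rewrite !inE.
Qed.

Lemma PL_surj (S T : finSemigroupType) (phi : {multiplicative S -> T}) :
  surj phi -> surj (dot_restr (@PL_dot S T phi)).
Proof.
move=> sphi [Y YT]; have [U [rho [VU rhoP]]] := PL_witness S.
pose G : {set T * U} :=
  [set p | [exists s, (phi s == p.1) && ((s, p.2) \in subsgp_set rho)]].
have GP t u : reflect (exists2 s, phi s = t & (s, u) \in subsgp_set rho)
    ((t, u) \in G).
  rewrite inE; apply: (iffP existsP) => [[s /andP[/eqP]]|[s st su]].
    by exists s.
  by exists s; rewrite st eqxx.
have Gm : mulg_closed G.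
  move=> [t u] [t' u'] /GP[s <- su] /GP[s' <- su']; apply/GP.
  by exists (s * s'); [rewrite gmulfM|exact: (subsgp_closed su su')].
have Gp t : exists u, (t, u) \in G.
  have [s <-] := sphi t; have [u su] := rm_proj rho s.
  by exists u; apply/GP; exists s.
have /PLP/(_ _ (@RelMorph _ _ (Subsgp Gm) Gp) VU)/nerveP[u Yu] := YT.
pose X0 := [set s in rm_preim rho u | phi s \in val Y].
have X0Y y : y \in val Y -> exists2 s, s \in X0 & phi s = y.
  move=> yY; have := subsetP Yu _ yY; rewrite inE => /GP[s sy su].
  by exists s => //; rewrite !inE su sy.
have X0n : X0 != set0.
  have [y yY] := psetP Y; have [s sX _] := X0Y y yY.
  by apply/set0Pn; exists s.
pose X : pset S := Pset X0n.
have XS : X \in cplx_set (PL_cplx S).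
  apply: (subsetP rhoP); apply/nerveP; exists u.
  by apply/subsetP => s; rewrite inE => /andP[].
exists (exist _ X XS); apply: val_inj; apply: val_inj; apply/setP => y /=.
apply/imsetP/idP => [[s]|yY]; first by rewrite inE => /andP[_ ?] ->.
by have [s sX sy] := X0Y y yY; exists s.
Qed.

Definition PL : complexFunctor := @ComplexFunctor PL_cplx PL_dot PL_surj.

End Pointlikes.

(* Classes of elements of a large poset are predicates; their joins and meets
   are expressed by their universal properties. *)
Section OrderNotions.
Variables (P : Type) (le : P -> P -> Prop).

Definition is_poset : Prop :=
  [/\ forall x, le x x,
      forall x y z, le x y -> le y z -> le x z &
      forall x y, le x y -> le y x -> x = y].

Definition is_join (A : P -> Prop) (x : P) : Prop :=
  (forall y, A y -> le y x) /\
  (forall z, (forall y, A y -> le y z) -> le x z).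

Definition is_meet (A : P -> Prop) (x : P) : Prop :=
  (forall y, A y -> le x y) /\
  (forall z, (forall y, A y -> le z y) -> le z x).

Definition is_complete_lattice : Prop :=
  is_poset /\
  forall A : P -> Prop, (exists x, is_join A x) /\ (exists x, is_meet A x).

End OrderNotions.

Definition galois_connection (P1 P2 : Type)
    (le1 : P1 -> P1 -> Prop) (le2 : P2 -> P2 -> Prop)
    (lower : P1 -> P2) (upper : P2 -> P1) : Prop :=
  [/\ forall x y, le1 x y -> le2 (lower x) (lower y),
      forall x y, le2 x y -> le1 (upper x) (upper y) &
      forall x1 x2, le2 (lower x1) x2 <-> le1 x1 (upper x2)].

(* Main.v *)
Require Import Defs.
From HB Require Import structures.
From mathcomp Require Import all_boot.
From mathcomp Require Import boolp.

Set Implicit Arguments.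
Unset Strict Implicit.
Unset Printing Implicit Defensive.

Local Open Scope group_scope.

(** The statement reduces to three facts.

    First, [PL V] is the largest complex functor fixing [V]. It fixes exactly
    [V] ([Fix_PL]): a semigroup whose pointlikes are all singletons admits a
    relational morphism to a member of [V] with fibres of at most one element,
    and so is a quotient of a subsemigroup of it. Every complex functor [C] fixing
    [V] lies below [PL V] ([le_PL]): lift a member of [C S] to the graph of a
    relational morphism, using that [C] preserves surjections, and project it to
    the codomain, where it becomes a singleton. These two facts are the
    adjunction between [Fix] and [PL], together with the identity which makes
    [Fix] surjective and [PL] injective.

    Secondly, a complex functor is a monad exactly when its values are closed
    under unions ([monad_absorbs], [absorbs_monad]). Relational morphisms extend
    to the semigroup of pointlikes, so [PL V] is a monad ([PL_absorbs]).
    The completion of [C] is one as well: by finiteness it is attained at a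
    finite stage over [S], so it is closed under unions of members of [C] over
    itself ([completion_absorbs]), and this closure passes from [C] to its
    completion ([absorbs_completion]). It is the least monad above [C]
    ([completion_min]), which is the adjunction between complex functors and
    monads. As [PL (Fix C)] is a monad above [C], it is also above the
    completion of [C]; hence completion does not change [Fix], and the triangle
    commutes.

    Thirdly, arbitrary joins suffice for completeness. Joins of complex functors
    are generated pointwise, and surjections are lifted along the generation;
    joins of monads are completions of these; joins of pseudovarieties in the
    opposite order are intersections. *)

(** * Extensionality and homomorphisms *)

Definition hom_of (S T : finSemigroupType) (f : S -> T)
    (fM : {morph f : x y / x * y}) : {multiplicative S -> T} :=
  HB.pack f (isMultiplicative.Build S T f fM).

Lemma subsgp_ext (S : finSemigroupType) (A B : subsgp S) :
  subsgp_set A = subsgp_set B -> A = B.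
Proof.
case: A B => [A cA] [B cB] /= eAB; subst B.
by congr Subsgp; exact: Prop_irrelevance.
Qed.

Lemma cplx_ext (S : finSemigroupType) (K L : cplx S) :
  cplx_set K = cplx_set L -> K = L.
Proof.
case: K L => [K sK dK] [L sL dL] /subsgp_ext /= eKL; subst L.
by congr Cplx; exact: Prop_irrelevance.
Qed.

Lemma CF_le_refl C : CF_le C C.
Proof. by move=> S. Qed.

Lemma CF_le_trans C D E : CF_le C D -> CF_le D E -> CF_le C E.
Proof. by move=> CD DE S; exact: subset_trans (CD S) (DE S). Qed.

Lemma CF_le_anti C D : CF_le C D -> CF_le D C -> C = D.
Proof.
case: C D => [C dC sC] [D dD sD] CD DC.
have eCD : C = D.
  apply: functional_extensionality_dep => S; apply/cplx_ext/eqP.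
  by rewrite eqEsubset (CD S) (DC S).
subst D; have edC : dC = dD by exact: Prop_irrelevance.
by subst dD; congr ComplexFunctor; exact: Prop_irrelevance.
Qed.

Lemma PV_le_anti V W : PV_le V W -> PV_le W V -> V = W.
Proof.
case: V W => [V vs vi vp] [W ws wi wp] VW WV.
have eVW : V = W.
  by apply: funext => S; apply: propext; split; [exact: VW|exact: WV].
by subst W; congr Pseudovariety; exact: Prop_irrelevance.
Qed.

(** * Unions of members of a complex *)

(** A subset of the image of [X] is the image of its preimage in [X]. Thus, in
    complexes given by closing a set downwards, lifting the upper bound of a
    member is enough to lift the member. *)
Lemma dot_sub_lift (S T : finSemigroupType) (phi : {multiplicative S -> T})
    (X : pset S) (Y : pset T) :
  val Y \subset val (dot phi X) ->
  exists2 X' : pset S, val X' \subset val X & dot phi X' = Y.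
Proof.
move=> YX; pose X0 := [set s in val X | phi s \in val Y].
have X0Y y : y \in val Y -> exists2 s, s \in X0 & phi s = y.
  move=> yY; have /imsetP[s sX ys] := subsetP YX _ yY.
  by exists s => //; rewrite inE sX -ys.
have X0n : X0 != set0.
  by have [y /X0Y[s sX _]] := psetP Y; apply/set0Pn; exists s.
exists (Pset X0n); first by apply/subsetP => s; rewrite inE => /andP[].
apply: val_inj; apply/setP => y /=; apply/imsetP/idP => [[s]|/X0Y[s sX sy]].
  by rewrite inE => /andP[_ ?] ->.
by exists s.
Qed.

(** Stated for the image of an arbitrary homomorphism into the complex, so that
    it covers the naturality of the union maps, a unit law and associativity. *)
Lemma punion_dotP (S M : finSemigroupType) (K : cplx S)
    (f : {multiplicative M -> K}) (A : pset M) (s : S) :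
  reflect (exists2 m, m \in val A & s \in val (val (f m)))
          (s \in val (punion (dot f A))).
Proof.
apply: (iffP bigcupP) => [[_ /imsetP[m mA ->]]|[m mA sm]]; first by exists m.
by exists (f m) => //; exact: imset_f.
Qed.

Lemma punion_psing (S : finSemigroupType) (K : cplx S) (X : K) :
  punion (psing X) = val X.
Proof. by apply: val_inj; rewrite /= big_set1. Qed.

Lemma punionM (S : finSemigroupType) (K : cplx S) :
  {morph @punion S K : A B / A * B}.
Proof.
move=> A B; apply: val_inj; apply/setP => s; apply/bigcupP/imset2P.
  move=> [_ /imset2P[X Y XA YB ->] /imset2P[x y xX yY ->]].
  by exists x y => //; apply/bigcupP; [exists X|exists Y].
move=> [x y /bigcupP[X XA xX] /bigcupP[Y YB yY] ->].
by exists (X * Y); apply/imset2P; [exists X Y|exists x y].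
Qed.

Lemma punion_dot_restr (S T : finSemigroupType) (phi : {multiplicative S -> T})
    (K : cplx S) (L : cplx T)
    (phiKL : forall X, X \in cplx_set K -> dot phi X \in cplx_set L)
    (A : pset K) :
  punion (dot (dot_restr phiKL) A) = dot phi (punion A).
Proof.
apply: val_inj; apply/setP => t; apply/punion_dotP/imsetP.
  by move=> [X XA /imsetP[s sX ->]]; exists s => //; apply/bigcupP; exists X.
by move=> [s /bigcupP[X XA sX] ->]; exists X => //; exact: imset_f.
Qed.

(** For [K] equal to [C S] this says that the union map from [C (C S)] takes its
    values in [C S]; a general complex [K] is allowed because the iterates of the
    completion are compared with one fixed complex. *)
Definition absorbs (C : complexFunctor) (S : finSemigroupType) (K : cplx S) :=
  forall A : pset K, A \in cplx_set (C K) -> punion A \in cplx_set K.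

Lemma psing_in (S : finSemigroupType) (K : cplx S) (x : S) :
  psing x \in cplx_set K.
Proof. by apply: (subsetP (cplx_sing K)); exact: imset_f. Qed.

Lemma psingM (S : finSemigroupType) : {morph @psing S : x y / x * y}.
Proof. by move=> x y; apply: val_inj; rewrite /= imset2_set1l imset_set1. Qed.

Section CplxMaps.
Variables (S : finSemigroupType) (K : cplx S).

Definition cplx_unit (x : S) : K := exist _ (psing x) (psing_in K x).

Lemma cplx_unitM : {morph cplx_unit : x y / x * y}.
Proof. by move=> x y; apply: val_inj; exact: psingM. Qed.

Definition cplx_unit_hom : {multiplicative S -> K} := hom_of cplx_unitM.

Variable L : cplx K.
Hypothesis KL : forall A, A \in cplx_set L -> punion A \in cplx_set K.

Definition cplx_union (A : L) : K := exist _ (punion (val A)) (KL (valP A)).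

Lemma cplx_unionM : {morph cplx_union : A B / A * B}.
Proof. by move=> A B; apply: val_inj; exact: punionM. Qed.

Definition cplx_union_hom : {multiplicative L -> K} := hom_of cplx_unionM.

Lemma punion_cplx_union (A : pset L) :
  punion (dot cplx_union_hom A) = punion (punion A).
Proof.
apply: val_inj; apply/setP => s; apply/punion_dotP/bigcupP.
  move=> [a aA /bigcupP[X Xa sX]]; exists X => //; by apply/bigcupP; exists a.
by move=> [X /bigcupP[a aA Xa] sX]; exists a => //; apply/bigcupP; exists X.
Qed.

End CplxMaps.

Lemma punion_cplx_unit (S : finSemigroupType) (K : cplx S) (X : pset S) :
  punion (dot (cplx_unit_hom K) X) = X.
Proof.
apply: val_inj; apply/setP => s; apply/punion_dotP/idP.
  by move=> [x xX /set1P->].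
by move=> sX; exists s => //; exact: set11.
Qed.

(** The unit and the multiplication of a complex monad are prescribed, and the
    naturality and monad laws are identities between unions of sets. So being a
    monad is the same as being closed under unions: this lemma and the next. *)
Lemma monad_absorbs C S : is_complex_monad C -> absorbs C (C S).
Proof.
move=> [M [_ multE]] A AC.
by have := multE S (exist _ A AC) => /= <-; exact: valP.
Qed.

Lemma absorbs_monad C : (forall S, absorbs C (C S)) -> is_complex_monad C.
Proof.
move=> Cabs.
pose unit (S : finSemigroupType) : {multiplicative S -> cf_functor C S} :=
  cplx_unit_hom (C S).
pose mult (S : finSemigroupType) :
    {multiplicative cf_functor C (cf_functor C S) -> cf_functor C S} :=
  cplx_union_hom (@Cabs S).
have unitN (S T : finSemigroupType) (phi : {multiplicative S -> T}) :
    fmap (cf_functor C) phi \o unit S =1 unit T \o phi.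
  by move=> x; do 2 apply: val_inj; rewrite /= imset_set1.
have multN (S T : finSemigroupType) (phi : {multiplicative S -> T}) :
    fmap (cf_functor C) phi \o mult S =1
    mult T \o fmap (cf_functor C) (fmap (cf_functor C) phi).
  by move=> A; apply: val_inj; rewrite /= punion_dot_restr.
have unitl (S : finSemigroupType) : mult S \o unit (cf_functor C S) =1 id.
  by move=> X; apply: val_inj; exact: punion_psing.
have unitr (S : finSemigroupType) : mult S \o fmap (cf_functor C) (unit S) =1 id.
  by move=> X; apply: val_inj; exact: punion_cplx_unit.
have multA (S : finSemigroupType) : mult S \o fmap (cf_functor C) (mult S) =1
    mult S \o mult (cf_functor C S).
  by move=> A; apply: val_inj; exact: punion_cplx_union.
by exists (MonadStructure unitN multN unitl unitr multA).
Qed.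

(** * Pointlikes *)

Lemma Fix_anti C D : CF_le C D -> PV_le (Fix D) (Fix C).
Proof.
move=> CD S /Fix_memP SD; apply/Fix_memP => X /(subsetP (CD S)); exact: SD.
Qed.

Lemma PL_anti V W : PV_le V W -> CF_le (PL W) (PL V).
Proof.
by move=> VW S; apply/subsetP => X /PLP hX; apply/PLP => T rho /VW; exact: hX.
Qed.

(** A relational morphism from [S] to [T] is a span of homomorphisms out of its
    graph, the leg to [S] being surjective. A member of [C S] therefore lifts to
    a member of [C] at the graph, whose image in [T] is a singleton [{t}] when
    [C] fixes [T]; the original set then lies in the fibre over [t]. *)
Lemma le_PL V C : PV_le V (Fix C) -> CF_le C (PL V).
Proof.
move=> VC S; apply/subsetP => X XC; apply/PLP => T rho VT.
have pM : {morph (fun a : rho => (val a).1) : x y / x * y} by [].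
pose pS := hom_of pM.
have qM : {morph (fun a : rho => (val a).2) : x y / x * y} by [].
pose qT := hom_of qM.
have pS_surj : surj pS.
  move=> s; have [t st] := rm_proj rho s.
  by exists (exist _ (s, t) st).
have [Z ZE] := cf_surj pS_surj (exist _ X XC : C S).
have {ZE} <- : dot pS (val Z) = X by have := congr1 val ZE.
have := cf_dot qT (valP Z); rewrite (VC T VT : cplx_set (C T) = sing T).
move=> /imsetP[t _ Zt]; apply/nerveP; exists t.
apply/subsetP => _ /imsetP[a aZ ->]; rewrite inE /=.
have /set1P <- : (val a).2 \in [set t].
  by rewrite -[[set t]]/(val (psing t)) -Zt; exact: (imset_f qT aZ).
by rewrite -surjective_pairing; exact: valP.
Qed.

(** If the [V]-pointlike sets of [S] are singletons, then so are the non-empty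
    fibres of one relational morphism to some [T] in [V] which computes them.
    Sending a point of its image to its only preimage then makes [S] a quotient
    of a subsemigroup of [T]. Conversely, for [S] in [V], the identity relation
    on [S] bounds the pointlikes by the singletons. *)
Lemma Fix_PL V : Fix (PL V) = V.
Proof.
apply: PV_le_anti => S.
  move=> /Fix_memP hS; have [T [rho [VT rhoPL]]] := PL_witness V S.
  have fib t s s' : (s, t) \in subsgp_set rho -> (s', t) \in subsgp_set rho ->
      s = s'.
    move=> st s't.
    have X0 : rm_preim rho t != set0 by apply/set0Pn; exists s; rewrite inE.
    apply: (hS (Pset X0)); try by rewrite inE.
    by apply: (subsetP rhoPL); apply/nerveP; exists t.
  pose I : {set T} := [set t | [exists s, (s, t) \in subsgp_set rho]].
  have IM : mulg_closed I.
    move=> t u; rewrite !inE => /existsP[s st] /existsP[r ru]; apply/existsP.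
    by exists (s * r); exact: (subsgp_closed st ru).
  have Iex (t : Subsgp IM) : exists s, (s, val t) \in subsgp_set rho.
    by apply/existsP; have := valP t; rewrite inE.
  have fM : {morph (fun t => xchoose (Iex t)) : x y / x * y}.
    move=> t u; apply: (fib (val t * val u)); first exact: (xchooseP (Iex (t * u))).
    exact: (subsgp_closed (xchooseP (Iex t)) (xchooseP (Iex u))).
  apply: (@pv_img V _ _ (hom_of fM)); last exact: pv_sub VT.
  move=> s; have [t st] := rm_proj rho s.
  have tI : t \in I by rewrite inE; apply/existsP; exists s.
  by exists (exist _ t tI); apply: (fib t) => //; exact: (xchooseP (Iex _)).
move=> VS; apply/Fix_memP => X /PLP hX x y xX yX.
pose G : {set S * S} := [set p | p.1 == p.2].
have GM : mulg_closed G.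
  by move=> [a b] [c d]; rewrite !inE /= => /eqP-> /eqP->.
have Gp s : exists t, (s, t) \in G by exists s; rewrite inE.
have /nerveP[t Xt] := hX S (@RelMorph _ _ (Subsgp GM) Gp) VS.
have := subsetP Xt _ xX; have := subsetP Xt _ yX.
by rewrite !inE /= => /eqP-> /eqP->.
Qed.

Lemma Fix_PL_galois C V : PVop_le (Fix C) V <-> CF_le C (PL V).
Proof.
split; first exact: le_PL.
by move=> CV S VS; apply: (Fix_anti CV); rewrite Fix_PL.
Qed.

(** A relational morphism from [S] to [T] induces one from the semigroup of
    pointlikes of [S] to [T], relating [X] to [t] when [X] lies in the fibre over
    [t]. A set of pointlikes in a fibre of the latter has its union in the
    corresponding fibre of the former. *)
Lemma PL_absorbs V S : absorbs (PL V) (PL V S).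
Proof.
move=> A /PLP hA; apply/PLP => T rho VT.
pose G : {set (PL V S : finSemigroupType) * T} :=
  [set p : PL V S * T | val (val p.1) \subset rm_preim rho p.2].
have GM : mulg_closed G.
  move=> [X t] [Y u]; rewrite !inE /= => /subsetP Xt /subsetP Yu.
  apply/subsetP => _ /imset2P[x y /Xt + /Yu + ->].
  by rewrite !inE => xt yu; exact: (subsgp_closed xt yu).
have Gp X : exists t, (X, t) \in G.
  have /PLP/(_ T rho VT)/nerveP[t Xt] := valP X.
  by exists t; rewrite inE.
have /nerveP[t /subsetP At] := hA T (@RelMorph _ _ (Subsgp GM) Gp) VT.
apply/nerveP; exists t; apply/bigcupsP => X /At.
by rewrite !inE.
Qed.

Lemma PL_monad V : is_complex_monad (PL V).
Proof. exact: absorbs_monad (@PL_absorbs V). Qed.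

(** * Monad completion *)

Lemma sing_dot (S T : finSemigroupType) (phi : {multiplicative S -> T}) X :
  X \in cplx_set (sing_cplx S) -> dot phi X \in cplx_set (sing_cplx T).
Proof.
move=> /imsetP[x _ ->]; apply/imsetP; exists (phi x) => //.
by apply: val_inj; rewrite /= imset_set1.
Qed.

Lemma sing_surj (S T : finSemigroupType) (phi : {multiplicative S -> T}) :
  surj phi -> surj (dot_restr (@sing_dot S T phi)).
Proof.
move=> sphi [Y Ysing]; have /imsetP[y _ YE] := Ysing.
have [x xy] := sphi y; exists (cplx_unit (sing_cplx S) x).
by do 2 apply: val_inj; rewrite /= YE imset_set1 /= xy.
Qed.

Definition sing_functor : complexFunctor := ComplexFunctor sing_surj.

Section StepFunctor.
Variables C D : complexFunctor.

Lemma step_dot (S T : finSemigroupType) (phi : {multiplicative S -> T}) X :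
  X \in cplx_set (completion_step C (D S)) ->
  dot phi X \in cplx_set (completion_step C (D T)).
Proof.
move=> /completion_stepP[A AC XA].
apply/completion_stepP; exists (dot (cf_map D phi) A); first exact: cf_dot.
by rewrite punion_dot_restr; exact: imsetS.
Qed.

(** Lift a member of [C (D T)] along the surjection [cf_map D phi], then restrict
    its union. *)
Lemma step_surj (S T : finSemigroupType) (phi : {multiplicative S -> T}) :
  surj phi -> surj (dot_restr (@step_dot S T phi)).
Proof.
move=> sphi [Y YT]; have /completion_stepP[B BC YB] := YT.
have [A AE] := cf_surj (cf_surj sphi) (exist _ B BC : C (D T)).
have {AE} BE : dot (cf_map D phi) (val A) = B by have := congr1 val AE.
rewrite -BE punion_dot_restr in YB.
have [X XA XY] := dot_sub_lift YB.
have XS : X \in cplx_set (completion_step C (D S)).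
  by apply/completion_stepP; exists (val A) => //; exact: valP.
by exists (exist _ X XS); apply: val_inj.
Qed.

Definition step_functor : complexFunctor := ComplexFunctor step_surj.
End StepFunctor.

(** The iterates, whose values are given object by object by [completion_iter],
    reassembled as complex functors. *)
Definition iter_functor C n := iter n (step_functor C) sing_functor.

Lemma iter_functorE C n S : iter_functor C n S = completion_iter C S n.
Proof. by elim: n => //= n <-. Qed.

(** The increasing union of iterates is attained, since [S] has finitely many
    subsets. *)
Lemma completion_stab C S : exists n, completion C S = completion_iter C S n.
Proof.
have ex (X : completion C S) : exists n, val X \in cplx_set (completion_iter C S n).
  exact/completionP/valP.
have [f fP] := fin_all_exists ex.
exists (\max_X f X); apply/cplx_ext/eqP; rewrite eqEsubset; apply/andP; split.
  apply/subsetP => X XC; apply: subsetP (fP (exist _ X XC)).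
  exact/completion_iter_incr/leq_bigmax.
by apply/subsetP => X Xn; apply/completionP; exists (\max_X f X).
Qed.

Lemma completion_dot C (S T : finSemigroupType) (phi : {multiplicative S -> T}) X :
  X \in cplx_set (completion C S) -> dot phi X \in cplx_set (completion C T).
Proof.
move=> /completionP[n]; rewrite -iter_functorE => Xn.
by apply/completionP; exists n; rewrite -iter_functorE; exact: cf_dot.
Qed.

Lemma completion_surj C (S T : finSemigroupType) (phi : {multiplicative S -> T}) :
  surj phi -> surj (dot_restr (@completion_dot C S T phi)).
Proof.
move=> sphi [Y YC]; have /completionP[n] := YC; rewrite -iter_functorE => Yn.
have [X XE] := cf_surj sphi (exist _ Y Yn : iter_functor C n T).
have XC : val X \in cplx_set (completion C S).
  by apply/completionP; exists n; rewrite -iter_functorE; exact: valP.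
by exists (exist _ (val X) XC); apply: val_inj; have := congr1 val XE.
Qed.

Definition completion_functor C : complexFunctor :=
  ComplexFunctor (@completion_surj C).

(** At the stage [n] where the iterates stabilise, the union of a member of
    [C (completion_iter C S n)] lies in stage [n.+1], hence in the completion. *)
Lemma completion_absorbs C S : absorbs C (completion C S).
Proof.
have [n nE] := completion_stab C S; rewrite nE => A AC.
rewrite -(congr1 (@cplx_set S) nE); apply/completionP.
by exists n.+1; apply/completion_stepP; exists A.
Qed.

(** Induction on the stage. A member of stage [n.+1] over [K] lies in the union
    of some [B] in [C] of stage [n]; by the induction hypothesis the union map is
    a homomorphism from stage [n] to [K], and the image of [B] under it is a
    member of [C K] with the same total union as [B]. *)
Lemma absorbs_completion C (S : finSemigroupType) (K : cplx S) :
  absorbs C K -> absorbs (completion_functor C) K.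
Proof.
move=> Kabs A /completionP[n]; elim: n A => [|n IHn] A.
  by move=> /imsetP[X _ ->]; rewrite punion_psing; exact: valP.
move=> /completion_stepP[B BC AB].
have := Kabs _ (cf_dot (cplx_union_hom IHn) BC); rewrite punion_cplx_union.
move=> BK; apply: (cplx_down BK).
apply/bigcupsP => X /(subsetP AB) XB.
exact: (bigcup_sup X).
Qed.

Lemma completion_monad C : is_complex_monad (completion_functor C).
Proof.
by apply: absorbs_monad => S; apply: absorbs_completion; exact: completion_absorbs.
Qed.

(** [X] is the union of the set of singletons of its elements, which is its image
    under the unit and so a member of [C (sing_cplx S)]. *)
Lemma le_completion C : CF_le C (completion_functor C).
Proof.
move=> S; apply/subsetP => X XC; apply/completionP; exists 1%N; apply/completion_stepP.
exists (dot (cplx_unit_hom (sing_cplx S)) X); first exact: cf_dot.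
by rewrite punion_cplx_unit.
Qed.

(** Each stage over [S] embeds in [D S], so a member of [C] at that stage is sent
    to a member of [D (D S)], whose union lies in [D S]. *)
Lemma completion_min C D :
  is_complex_monad D -> CF_le C D -> CF_le (completion_functor C) D.
Proof.
move=> Dmon CD S; apply/subsetP => X /completionP[n]; elim: n X => [|n IHn] X.
  exact: (subsetP (cplx_sing (D S))).
move=> /completion_stepP[A AC XA].
have iM : {morph (fun Y : completion_iter C S n =>
    exist _ (val Y) (IHn _ (valP Y)) : D S) : Y Z / Y * Z}.
  by move=> Y Z; apply: val_inj.
pose i := hom_of iM.
have AD : dot i A \in cplx_set (D (D S)).
  by apply: (subsetP (CD _)); exact: cf_dot.
apply: cplx_down (monad_absorbs Dmon AD) _.
apply: (subset_trans XA); apply/subsetP => s /bigcupP[Y YA sY].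
by apply/punion_dotP; exists Y.
Qed.

(** * Complete lattices *)

Section ClosureJoin.
Variable A : complexFunctor -> Prop.

(** The smallest complex containing all the [C S] with [C] in [A]. Presenting it
    by generation lets functoriality and, above all, the lifting along
    surjections be proved rule by rule. *)
Inductive in_join (S : finSemigroupType) : pset S -> Prop :=
| join_sing x : in_join (psing x)
| join_mem C X of A C & X \in cplx_set (C S) : in_join X
| join_mul (X Y : pset S) of in_join X & in_join Y : in_join (X * Y)
| join_down (X Y : pset S) of in_join X & val Y \subset val X : in_join Y.

Definition join_set (S : finSemigroupType) : {set pset S} :=
  [set X | `[< in_join X >]].

Lemma join_setP (S : finSemigroupType) (X : pset S) :
  reflect (in_join X) (X \in join_set S).
Proof. by rewrite inE; exact: asboolP. Qed.

Lemma join_set_closed (S : finSemigroupType) : mulg_closed (join_set S).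
Proof.
by move=> X Y /join_setP gX /join_setP gY; apply/join_setP; exact: join_mul.
Qed.

Lemma join_set_sing (S : finSemigroupType) : sing S \subset join_set S.
Proof. by apply/subsetP => _ /imsetP[x _ ->]; apply/join_setP; exact: join_sing. Qed.

Lemma join_set_down (S : finSemigroupType) (X Y : pset S) :
  X \in join_set S -> val Y \subset val X -> Y \in join_set S.
Proof. by move=> /join_setP gX YX; apply/join_setP; exact: join_down YX. Qed.

Definition join_cplx (S : finSemigroupType) : cplx S :=
  @Cplx S (Subsgp (@join_set_closed S)) (@join_set_sing S) (@join_set_down S).

Lemma join_dot (S T : finSemigroupType) (phi : {multiplicative S -> T}) X :
  X \in cplx_set (join_cplx S) -> dot phi X \in cplx_set (join_cplx T).
Proof.
move=> /join_setP gX; apply/join_setP.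
elim: gX => {X} [x|C X AC XC|X Y _ gX _ gY|X Y _ gX YX].
- suff -> : dot phi (psing x) = psing (phi x) by exact: join_sing.
  by apply: val_inj; rewrite /= imset_set1.
- exact: join_mem AC (cf_dot phi XC).
- by rewrite gmulfM; exact: join_mul.
- by apply: join_down gX _; exact: imsetS.
Qed.

Lemma join_surj (S T : finSemigroupType) (phi : {multiplicative S -> T}) :
  surj phi -> surj (dot_restr (@join_dot S T phi)).
Proof.
move=> sphi [Y YT]; suff [X gX XY] : exists2 X, in_join X & dot phi X = Y.
  have XS : X \in cplx_set (join_cplx S) by exact/join_setP.
  by exists (exist _ X XS); apply: val_inj.
have /join_setP gY := YT.
elim: gY => {Y YT} [y|C Y AC YC|Y Z _ [X gX <-] _ [X' gX' <-]|Y Z _ [X gX <-] ZY].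
- have [x xy] := sphi y; exists (psing x); first exact: join_sing.
  by apply: val_inj; rewrite /= imset_set1 xy.
- have [X XE] := cf_surj sphi (exist _ Y YC : C T).
  exists (val X); first exact: join_mem AC (valP X).
  by have := congr1 val XE.
- by exists (X * X'); [exact: join_mul|rewrite gmulfM].
- by have [X' X'X <-] := dot_sub_lift ZY; exists X' => //; exact: join_down X'X.
Qed.

Definition CF_join : complexFunctor := ComplexFunctor join_surj.

Lemma CF_joinP : is_join CF_le A CF_join.
Proof.
split=> [C AC S|D leD S]; apply/subsetP => X.
  by move=> XC; apply/join_setP; exact: join_mem AC XC.
move=> /join_setP; elim=> {X} [x|C X AC XC|X Y _ XD _ YD|X Y _ XD YX].
- exact: psing_in.
- exact: (subsetP (leD C AC S)).
- exact: (@subsgp_closed _ (cplx_subsgp (D S))).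
- exact: cplx_down YX.
Qed.
End ClosureJoin.

(** The meet of a class is the join of its lower bounds. *)
Lemma complete_lattice_of_joins (P : Type) (le : P -> P -> Prop) :
  is_poset le -> (forall A, exists x, is_join le A x) -> is_complete_lattice le.
Proof.
move=> leP joinP; split=> // A; split=> //.
have [x [xub xlub]] := joinP (fun z => forall y, A y -> le z y).
by exists x; split=> [y Ay|z zlb]; [apply: xlub => z; exact|exact: xub].
Qed.

Lemma CF_complete : is_complete_lattice CF_le.
Proof.
apply: complete_lattice_of_joins; last by move=> A; exists (CF_join A); exact: CF_joinP.
by split; [exact: CF_le_refl|exact: CF_le_trans|exact: CF_le_anti].
Qed.

Lemma CM_incl_inj : injective CM_incl.
Proof.
by move=> [C Cm] [D Dm] /= eCD; subst D; congr exist; exact: Prop_irrelevance.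
Qed.

Definition compl C : complexMonad := exist _ _ (completion_monad C).

Lemma compl_galois C (D : complexMonad) : CM_le (compl C) D <-> CF_le C (CM_incl D).
Proof.
split=> [|CD]; first exact/CF_le_trans/le_completion.
exact: completion_min (svalP D) CD.
Qed.

(** The complex monads are reflective in the complex functors, so the join of
    complex monads is the completion of their join as complex functors. *)
Lemma CM_complete : is_complete_lattice CM_le.
Proof.
apply: complete_lattice_of_joins.
  split=> [C|C D E|C D CD DC]; [exact: CF_le_refl|exact: CF_le_trans|].
  exact/CM_incl_inj/CF_le_anti.
move=> A; pose J := CF_join (fun C => exists2 D, A D & CM_incl D = C).
have [Jub Jlub] : is_join CF_le _ J := CF_joinP _.
exists (compl J); split=> [D AD|E Eub].
  by apply: CF_le_trans (le_completion J); apply: Jub; exists D.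
by apply/compl_galois/Jlub => _ [D AD <-]; exact: Eub.
Qed.

(** In the opposite order, joins of pseudovarieties are intersections. *)
Section PVInter.
Variable A : pseudovariety -> Prop.

Definition inter_mem (S : finSemigroupType) := forall V, A V -> V S.

Lemma inter_sub (S : finSemigroupType) (B : subsgp S) : inter_mem S -> inter_mem B.
Proof. by move=> hS V AV; exact/pv_sub/hS. Qed.

Lemma inter_img (S T : finSemigroupType) (phi : {multiplicative S -> T}) :
  surj phi -> inter_mem S -> inter_mem T.
Proof. by move=> sphi hS V AV; exact: pv_img sphi (hS V AV). Qed.

Lemma inter_prod (I : finType) (F : I -> finSemigroupType) :
  (forall i, inter_mem (F i)) -> inter_mem (prodsgp F).
Proof. by move=> hF V AV; apply: pv_prod => i; exact: hF. Qed.

Definition PV_inter : pseudovariety := Pseudovariety inter_sub inter_img inter_prod.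
End PVInter.

Lemma PVop_complete : is_complete_lattice PVop_le.
Proof.
apply: complete_lattice_of_joins.
  split=> [V S //|V W U VW WU S /WU/VW //|V W VW WV]; exact: PV_le_anti.
move=> A; exists (PV_inter A); split=> [V AV S|W Wub S WS V AV]; first exact.
exact: Wub AV _ WS.
Qed.

Lemma compl_CM_incl (D : complexMonad) : compl (CM_incl D) = D.
Proof.
apply: CM_incl_inj; apply: CF_le_anti; last exact: le_completion.
exact/compl_galois/CF_le_refl.
Qed.

(** [C] lies below the pointlikes functor of [Fix C], which is a monad, so the
    completion of [C] does too, and hence fixes [Fix C]. *)
Lemma Fix_compl C : Fix (CM_incl (compl C)) = Fix C.
Proof.
apply: PV_le_anti; first exact/Fix_anti/le_completion.
apply/Fix_PL_galois; apply: completion_min; first exact: PL_monad.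
exact/Fix_PL_galois.
Qed.

Definition PL_CM V : complexMonad := exist _ _ (PL_monad V).

(** * The triangle of Galois connections *)

Theorem mainTheorem3 :
  (* (1) *)
  ((forall V : pseudovariety,
      PV_le V (Fix (PL V)) /\
      is_join CF_le (fun C : complexFunctor => PV_le V (Fix C)) (PL V)) /\
   galois_connection CF_le PVop_le Fix PL /\
   (forall V : pseudovariety, is_complex_monad (PL V))) /\
  (* (2) *)
  (is_complete_lattice CF_le /\
   is_complete_lattice CM_le /\
   is_complete_lattice PVop_le /\
   exists (compl : complexFunctor -> complexMonad)
          (PL_CM : pseudovariety -> complexMonad),
     (* compl is the monad completion map *)
     (forall (C : complexFunctor) (S : finSemigroupType),
        cplx_set (CM_incl (compl C) S) = cplx_set (completion C S)) /\
     (* the triangle of upper adjoints commutes; this also determines PL_CM *)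
     (forall V : pseudovariety, CM_incl (PL_CM V) = PL V) /\
     (* CF and CM *)
     surj compl /\
     galois_connection CF_le CM_le compl CM_incl /\
     (* CF and PV^op *)
     surj Fix /\
     injective PL /\
     galois_connection CF_le PVop_le Fix PL /\
     (* CM and PV^op *)
     surj (fun C : complexMonad => Fix (CM_incl C)) /\
     injective PL_CM /\
     galois_connection CM_le PVop_le
       (fun C : complexMonad => Fix (CM_incl C)) PL_CM /\
     (* the triangle of lower adjoints commutes *)
     (forall C : complexFunctor, Fix (CM_incl (compl C)) = Fix C)).
Proof.
have FixPL_gal : galois_connection CF_le PVop_le Fix PL.
  by split; [exact: Fix_anti|move=> V W; exact: PL_anti|exact: Fix_PL_galois].
split; last (split; [exact: CF_complete|split; [exact: CM_complete|
  split; [exact: PVop_complete|exists compl, PL_CM]]]).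
  split; [move=> V|by split; [|exact: PL_monad]].
  have VPL : PV_le V (Fix (PL V)) by rewrite Fix_PL.
  split=> //; split=> [C|D Dub]; [exact: le_PL|exact: Dub].
do 2 (split; first by []).
split; first by move=> D; exists (CM_incl D); exact: compl_CM_incl.
split.
  split=> [C D CD|//|]; last exact: compl_galois.
  by apply/compl_galois/(CF_le_trans CD)/le_completion.
split; first by move=> V; exists (PL V); exact: Fix_PL.
split; first exact: can_inj Fix_PL.
split; first exact: FixPL_gal.
split; first by move=> V; exists (PL_CM V); exact: Fix_PL.
split; first exact: (@can_inj _ _ PL_CM (fun C => Fix (CM_incl C)) Fix_PL).
split; last exact: Fix_compl.
by split=> [C D|V W|C V]; [exact: Fix_anti|exact: PL_anti|exact: Fix_PL_galois].
Qed.
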